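(* Let $i,j$ be integers with $0\leq i\leq j$ and $j\geq 1$. For any connected graph $G$, $\gamma_{i/j}(G)\leq \lceil (i/j)\,\gamma(G)\rceil$.
   Context: All graphs are finite and simple. For a graph $G=(V,E)$ and $v\in V$, $N[v]=\{v\}\cup\{u : uv\in E\}$, and for $S\subseteq V$, $N[S]=\bigcup_{u\in S}N[u]$. A set $S$ is dominating if $N[S]=V$, and $\gamma(G)$ is the minimum cardinality of a dominating set. For $p\in[0,1]$, a set $S\subseteq V$ is a $p$-dominating set if $|N[S]|/|V|\geq p$; $\gamma_p(G)$ is the minimum cardinality of a $p$-dominating set of $G$. *)

(* Defs.v *)
From mathcomp Require Import all_boot all_order all_algebra.

Set Implicit Arguments.
Unset Strict Implicit.
Unset Printing Implicit Defensive.

Import Order.TTheory GRing.Theory Num.Theory.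

(* A finite simple graph is a symmetric irreflexive relation e on V : finType. *)

Section Domination.

Variables (V : finType) (e : rel V).

(* The graph with no vertices does not count as connected. *)
Definition connected_graph : Prop :=
  (0 < #|V|)%N /\ forall x y : V, connect e x y.

Definition closed_nbhd (v : V) : {set V} := v |: [set u | e u v].

Definition closed_nbhd_set (S : {set V}) : {set V} :=
  \bigcup_(u in S) closed_nbhd u.

Definition dominating (S : {set V}) : bool := closed_nbhd_set S == [set: V].

Definition domination_number : nat :=
  #|[arg min_(S < [set: V] | dominating S) #|S|]%N|.

Variable R : realFieldType.

Definition p_dominating (p : R) (S : {set V}) : bool :=
  (p <= #|closed_nbhd_set S|%:R / #|V|%:R)%R.

(* [set: V] is p-dominating when V is nonempty and p <= 1; outside that range
   the value may be junk (the default #|V|). *)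
Definition p_domination_number (p : R) : nat :=
  #|[arg min_(S < [set: V] | p_dominating p S) #|S|]%N|.

Lemma closed_nbhd_setT : closed_nbhd_set [set: V] = [set: V].
Proof.
apply/setP => x; rewrite in_setT; apply/bigcupP.
by exists x; rewrite ?in_setT // /closed_nbhd setU11.
Qed.

Lemma domination_numberP :
  (exists2 S, dominating S & #|S| = domination_number) /\
  (forall S, dominating S -> domination_number <= #|S|)%N.
Proof.
rewrite /domination_number; case: arg_minnP => [|S domS minS].
  by rewrite /dominating closed_nbhd_setT.
by split; [exists S | exact: minS].
Qed.

Lemma p_domination_numberP (p : R) : (0 < #|V|)%N -> (p <= 1)%R ->
  (exists2 S, p_dominating p S & #|S| = p_domination_number p) /\
  (forall S, p_dominating p S -> p_domination_number p <= #|S|)%N.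
Proof.
move=> V_gt0 p_le1; rewrite /p_domination_number.
case: arg_minnP => [|S domS minS]; last by split; [exists S | exact: minS].
by rewrite /p_dominating closed_nbhd_setT cardsT divff // pnatr_eq0 -lt0n.
Qed.

End Domination.

(* Main.v *)
Require Import Defs.
From mathcomp Require Import all_boot all_order all_algebra.
Import Order.TTheory GRing.Theory Num.Theory.
Local Open Scope ring_scope.

(** Assign every vertex to one vertex of a minimum dominating set [D] that
    dominates it. This partitions the [n] vertices into [#|D|] classes, and by
    averaging the [k] largest classes together contain at least [k * n / #|D|]
    vertices; take [k] to be the ceiling of [(i / j) * #|D|]. *)

(** Induction on [#|D|]: discarding an element of least weight does not lower the average, so a good
    [A] for the rest of [D] stays good for [D]. *)
Lemma exists_subset_large_sum (T : finType) (w : T -> nat) (D : {set T}) k :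
  (k <= #|D| -> exists A : {set T}, [/\ A \subset D, #|A| = k &
    k * \sum_(x in D) w x <= #|D| * \sum_(x in A) w x])%N.
Proof.
move cardD: #|D| => n; elim: n D cardD => [|n IHn] D cardD.
  by rewrite leqn0 => /eqP->; exists set0; rewrite sub0set cards0.
rewrite leq_eqVlt => /predU1P[->|]; first by exists D.
rewrite ltnS => le_kn.
have [x0 Dx0] : exists x, x \in D by apply/card_gt0P; rewrite cardD.
have [x Dx w_min] : exists2 x, x \in D & forall y, y \in D -> (w x <= w y)%N.
  by case: (arg_minnP w Dx0) => x; exists x.
have cardDx : #|D :\ x| = n by move: (cardsD1 x D); rewrite Dx cardD => -[].
have [A [sADx cardA leA]] := IHn _ cardDx le_kn.
exists A; split=> //; first exact: subset_trans sADx (subsetDl _ _).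
(* The inequality is proved below after multiplication by [n], so [n = 0] is split off; there
   [k = 0]. *)
have [n0|n_gt0] := posnP n; first by move: le_kn; rewrite n0 leqn0 => /eqP->.
have min_le : (n * w x <= \sum_(y in D :\ x) w y)%N.
  rewrite -cardDx -sum_nat_const; apply: leq_sum => y.
  by rewrite !inE => /andP[_ /w_min].
rewrite -(leq_pmul2l n_gt0) (big_setD1 x Dx) /=.
(* With [S] the sum over [D :\ x], [min_le] gives [n * (w x + S) <= n.+1 * S]; the induction
   hypothesis then bounds [k * S]. *)
apply: (@leq_trans (n.+1 * (k * \sum_(y in D :\ x) w y))%N).
  rewrite mulnCA [leqRHS]mulnCA leq_mul2l; apply/orP; right.
  by rewrite mulnDr mulSn leq_add2r.
by rewrite [leqRHS]mulnCA leq_mul2l leA orbT.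
Qed.

Lemma exists_subset_large_closed_nbhd (V : finType) (e : rel V)
    (D : {set V}) k :
  dominating e D -> (k <= #|D|)%N ->
  exists A : {set V},
    [/\ A \subset D, #|A| = k &
        k * #|V| <= #|D| * #|closed_nbhd_set e A|]%N.
Proof.
move=> /eqP domD le_kD.
have dominatorP x : exists v, (v \in D) && (x \in closed_nbhd e v).
  have: x \in closed_nbhd_set e D by rewrite domD inE.
  by case/bigcupP=> v Dv xv; exists v; rewrite Dv.
(* Closed neighbourhoods may overlap; the fibres of [c] do not, so their sizes [w v] add up to
   exactly [#|V|] over [D]. *)
pose c x := xchoose (dominatorP x).
have cP x : (c x \in D) && (x \in closed_nbhd e (c x)) := xchooseP (dominatorP x).
pose w v := (\sum_(x | c x == v) 1)%N.
have sum_w (B : {set V}) : (\sum_(v in B) w v = #|[set x | c x \in B]|)%N.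
  rewrite -sum1dep_card [RHS](partition_big c (mem B)) //=.
  apply: eq_bigr => v Bv; apply: eq_bigl => x.
  by case: eqP => [->|]; rewrite ?Bv ?andbF.
have [A [sAD cardA]] := exists_subset_large_sum _ w _ _ le_kD.
rewrite !sum_w => leA; exists A; split=> //.
have cD : [set x | c x \in D] = [set: V].
  by apply/setP=> x; rewrite !inE; case/andP: (cP x).
rewrite -cardsT -cD (leq_trans leA) // leq_mul2l subset_leq_card ?orbT //.
(* A vertex whose chosen dominator [c x] is in [A] is dominated by [A]. *)
apply/subsetP=> x; rewrite inE => Acx; apply/bigcupP; exists (c x) => //.
by case/andP: (cP x).
Qed.

Theorem theorem3p4 (R : archiRealFieldType) (i j : int)
  (hi : 0 <= i) (hij : i <= j) (hj : 1 <= j)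
  (V : finType) (e : rel V) (e_sym : symmetric e) (e_irr : irreflexive e)
  (e_conn : connected_graph e) :
  (p_domination_number e (i%:~R / j%:~R : R))%:Z
    <= Num.ceil ((i%:~R / j%:~R : R) * (domination_number e)%:R).
Proof.
have [V_gt0 _] := e_conn.
have j_gt0 : 0 < j%:~R :> R by rewrite ltr0z.
set p : R := _ / _.
have p_ge0 : 0 <= p by rewrite divr_ge0 ?ler0z // (le_trans hi).
have p_le1 : p <= 1 by rewrite ler_pdivrMr // mul1r ler_int.
have [[D domD cardD] _] := domination_numberP e.
rewrite -cardD.
have D_gt0 : (0 < #|D|)%N.
  rewrite lt0n cards_eq0; apply: contraTneq domD => ->.
  by rewrite /dominating /closed_nbhd_set big_set0 eq_sym -cards_eq0 cardsT -lt0n.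
have ceil_nneg : 0 <= Num.ceil (p * #|D|%:R).
  by rewrite ceil_ge0 (lt_le_trans (ltrN10 R) (mulr_ge0 p_ge0 _)).
have ceil_le : Num.ceil (p * #|D|%:R) <= #|D|%:Z.
  by rewrite ceil_le_int ler_piMl ?ler0n.
have le_ceil := ceil_ge (p * #|D|%:R).
(* The ceiling lies between 0 and [#|D|], so it is a natural number [k] that can be the size of a
   subset of [D]. *)
case: (Num.ceil _) ceil_nneg ceil_le le_ceil => // k _ le_kD le_ceil.
have [A [_ cardA leA]] := exists_subset_large_closed_nbhd _ _ _ _ domD le_kD.
have [_ minp] := p_domination_numberP e V_gt0 p_le1.
rewrite -cardA lez_nat; apply: minp.
rewrite /p_dominating ler_pdivlMr ?ltr0n //.
(* Scaled by [#|D|], the goal follows by passing through [k * #|V|]: first [p * #|D| <= k], then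
   [leA]. *)
rewrite -(ler_pM2l (_ : 0 < #|D|%:R)) ?ltr0n // mulrA [#|D|%:R * p]mulrC.
apply: (@le_trans _ _ (k%:R * #|V|%:R)); first by rewrite ler_wpM2r ?ler0n.
by rewrite -!natrM ler_nat.
Qed.
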